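(* Let $n\ge1$, $z=(z_1,\dots,z_n)$, $t$ a formal parameter. For any $N_t(z)\in\mathbb{C}[t][[z]]^{n}$ with $o(N_t(z))\ge1$, the following are equivalent. (1) $z+tN_t(z)$ is the formal inverse of $z-tH(z)$ for some $H(z)\in\mathbb{C}[[z]]^{n}$. (2) For every $U(z)\in\mathbb{C}[[z]]$, the unique power series solution $U_t(z)$ in $z$ and $t$ of the Cauchy problem $$\frac{\partial U_t}{\partial t}=\langle \nabla U_t, N_t\rangle,\qquad U_{t=0}(z)=U(z)$$ is given by $U_t(z)=U(z+tN_t(z))$.
   Context: Vectors are column vectors; $\nabla$ is the gradient with respect to $z$; $\langle a,b\rangle=\sum_i a_ib_i$. For a vector of power series, the order $o(\cdot)$ is the minimum of the orders in $z$ (lowest total degree in $z$) of its components. Composition is in the variables $z$ with $t$ treated as a constant; $G_t$ is the formal inverse of $F_t$ if $F_t(G_t(z))=z=G_t(F_t(z))$. ''Power series solution in $z$ and $t$'' means a solution in $\mathbb{C}[[z,t]]$. *)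

(* Defs.v *)
From HB Require Import structures.
From mathcomp Require Import all_boot all_order all_algebra.
From mathcomp Require Import complex.
From mathcomp Require Import mpoly.
From mathcomp Require Import boolp constructive_ereal reals.

Set Implicit Arguments.
Unset Strict Implicit.
Unset Printing Implicit Defensive.

Import Order.TTheory GRing.Theory Num.Theory.

Local Open Scope ring_scope.

(* A[[x_0, ..., x_(n-1)]]: the coercion sends a series to its coefficients,
   indexed by the exponents m : 'X_{1..n} of the monomials. *)
Record mpseries (n : nat) (A : comNzRingType) :=
  MPSeries { pscoef :> 'X_{1..n} -> A }.

Section Ring.
Variables (n : nat) (A : comNzRingType).
Implicit Types (f g h : mpseries n A) (P Q : {mpoly A[n]}) (m : 'X_{1..n}).

Lemma mpseriesP f g : (forall m, f m = g m) -> f = g.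
Proof. by case: f g => [f] [g] /= /funext ->. Qed.

HB.instance Definition _ := gen_eqMixin (mpseries n A).
HB.instance Definition _ := gen_choiceMixin (mpseries n A).

Definition ps_zero : mpseries n A := MPSeries (fun=> 0).
Definition ps_opp f := MPSeries (fun m => - f m).
Definition ps_add f g := MPSeries (fun m => f m + g m).

Fact ps_addA : associative ps_add.
Proof. by move=> f g h; apply: mpseriesP => m /=; rewrite addrA. Qed.
Fact ps_addC : commutative ps_add.
Proof. by move=> f g; apply: mpseriesP => m /=; rewrite addrC. Qed.
Fact ps_add0 : left_id ps_zero ps_add.
Proof. by move=> f; apply: mpseriesP => m /=; rewrite add0r. Qed.
Fact ps_addN : left_inverse ps_zero ps_opp ps_add.
Proof. by move=> f; apply: mpseriesP => m /=; rewrite addNr. Qed.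

HB.instance Definition _ :=
  GRing.isZmodule.Build (mpseries n A) ps_addA ps_addC ps_add0 ps_addN.

Definition ps_one : mpseries n A := MPSeries (fun m => (m == 0%MM)%:R).
Definition ps_mul f g := MPSeries (fun m =>
  \sum_(k : 'X_{1..n < (mdeg m).+1, (mdeg m).+1} | m == (k.1 + k.2)%MM)
     f k.1 * g k.2).

Definition ps_approx d f P := forall m, (mdeg m <= d)%N -> P@_m = f m.

Lemma ps_approx_mul d f g P Q :
  ps_approx d f P -> ps_approx d g Q -> ps_approx d (ps_mul f g) (P * Q).
Proof.
move=> fP gQ m md; rewrite mcoeffM /=; apply: eq_bigr => k _.
by rewrite fP ?gQ // (leq_trans _ md) // -ltnS bmdeg.
Qed.

Lemma ps_approx1 d : ps_approx d ps_one 1.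
Proof. by move=> m _; rewrite mcoeff1. Qed.

Definition ps_trunc d f : {mpoly A[n]} :=
  \sum_(m : 'X_{1..n < d.+1}) f m *: 'X_[m].

Lemma ps_approx_trunc d f : ps_approx d f (ps_trunc d f).
Proof. by move=> m md; rewrite /ps_trunc mcoeff_mpoly. Qed.

Lemma ps_approx_eq f g (P : nat -> {mpoly A[n]}) :
  (forall d, ps_approx d f (P d)) -> (forall d, ps_approx d g (P d)) -> f = g.
Proof.
by move=> fP gP; apply: mpseriesP => m; rewrite -(fP (mdeg m)) ?(gP (mdeg m)).
Qed.

Fact ps_mulA : associative ps_mul.
Proof.
move=> f g h; pose T := ps_approx_trunc.
apply: (@ps_approx_eq _ _
  (fun d => ps_trunc d f * (ps_trunc d g * ps_trunc d h))) => d.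
  by do 2?[apply: ps_approx_mul]; exact: T.
by rewrite mulrA; do 2?[apply: ps_approx_mul]; exact: T.
Qed.
Fact ps_mulC : commutative ps_mul.
Proof.
move=> f g; pose T := ps_approx_trunc.
apply: (@ps_approx_eq _ _ (fun d => ps_trunc d f * ps_trunc d g)) => d.
  by apply: ps_approx_mul; exact: T.
by rewrite mulrC; apply: ps_approx_mul; exact: T.
Qed.
Fact ps_mul1 : left_id ps_one ps_mul.
Proof.
move=> f; pose T := ps_approx_trunc.
apply: (@ps_approx_eq _ _ (fun d => 1 * ps_trunc d f)) => d.
  by apply: ps_approx_mul; [exact: ps_approx1 | exact: T].
by rewrite mul1r; exact: T.
Qed.
Fact ps_mulDl : left_distributive ps_mul ps_add.
Proof.
move=> f g h; apply: mpseriesP => m /=; rewrite -big_split /=.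
by apply: eq_bigr => k _; rewrite mulrDl.
Qed.
Fact ps_one_neq0 : ps_one != 0.
Proof.
apply/eqP => /(congr1 (fun f : mpseries n A => f 0%MM)) /eqP.
by rewrite /= eqxx oner_eq0.
Qed.

HB.instance Definition _ := GRing.Zmodule_isComNzRing.Build (mpseries n A)
  ps_mulA ps_mulC ps_mul1 ps_mulDl ps_one_neq0.

End Ring.

Section Operations.
Variable A : comNzRingType.

Definition ps_var n (i : 'I_n) : mpseries n A :=
  MPSeries (fun m => (m == U_(i)%MM)%:R).

Definition ps_deriv n (i : 'I_n) (f : mpseries n A) : mpseries n A :=
  MPSeries (fun m => f (m + U_(i))%MM *+ (m i).+1).

(* Substitution f(g_0, ..., g_(k-1)).  All the g_i must have a zero constant
   coefficient: then g ^ a has no monomial of degree < mdeg a, and cutting the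
   sum off at mdeg a <= mdeg m loses nothing.  Otherwise the value is junk. *)
Definition ps_comp k n (f : mpseries k A) (g : 'cV[mpseries n A]_k) :
    mpseries n A :=
  MPSeries (fun m => \sum_(a : 'X_{1..k < (mdeg m).+1})
                       f a * (\prod_(i < k) g i 0 ^+ a i : mpseries n A) m).

(* Lowest total degree of a monomial of f; +oo for f = 0. *)
Definition ps_order n (f : mpseries n A) : \bar int :=
  if pselect (exists d, `[< exists m, mdeg m = d /\ f m <> 0 >]) is left f_neq0
  then ((ex_minn f_neq0)%:Z)%:E else +oo%E.

Definition ps_vorder n k (f : 'cV[mpseries n A]_k) : \bar int :=
  \big[Order.min/+oo%E]_(i < k) ps_order (f i 0).

Definition dotv k (a b : 'cV[A]_k) : A := \sum_(i < k) a i 0 * b i 0.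

End Operations.

(* C[[z, t]] is mpseries (n + 1) C: the first n variables are z, the last is t.
   Substituting for z in C[[z, t]] is well defined as soon as the constant
   coefficients in (z, t) vanish; in particular z - t H(z) may be substituted
   even when H(0) <> 0. *)
Section TimeVariable.
Variables (n : nat) (A : comNzRingType).

Definition zidx (i : 'I_n) : 'I_(n + 1) := lshift 1 i.
Definition tidx : 'I_(n + 1) := rshift n ord0.

Definition zexp (m : 'X_{1..n + 1}) : 'X_{1..n} :=
  [multinom m (zidx i) | i < n].
Definition ztexp (m : 'X_{1..n}) (k : nat) : 'X_{1..n + 1} :=
  [multinom (if split j is inl i then m i else k) | j < n + 1].

Definition tvar : mpseries (n + 1) A := ps_var A tidx.
Definition zvec : 'cV[mpseries (n + 1) A]_n := \col_i ps_var A (zidx i).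

(* The inclusions of A[[z]] and of A[t][[z]] in A[[z, t]]. *)
Definition ps_const_t (f : mpseries n A) : mpseries (n + 1) A :=
  MPSeries (fun m => if m tidx == 0%N then f (zexp m) else 0).
Definition ps_poly_t (f : mpseries n {poly A}) : mpseries (n + 1) A :=
  MPSeries (fun m => (f (zexp m))`_(m tidx)).

Definition ps_at_t0 (V : mpseries (n + 1) A) : mpseries n A :=
  MPSeries (fun m => V (ztexp m 0)).

Definition ps_dt (V : mpseries (n + 1) A) := ps_deriv tidx V.
Definition ps_grad (V : mpseries (n + 1) A) : 'cV[mpseries (n + 1) A]_n :=
  \col_i ps_deriv (zidx i) V.

Definition compz (V : mpseries (n + 1) A) (G : 'cV[mpseries (n + 1) A]_n) :
    mpseries (n + 1) A :=
  ps_comp V (col_mx G (const_mx tvar)).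

Definition formal_inverse (F G : 'cV[mpseries (n + 1) A]_n) : Prop :=
  map_mx (compz^~ G) F = zvec /\ map_mx (compz^~ F) G = zvec.

Definition cauchy_solution (N : 'cV[mpseries n {poly A}]_n)
    (U : mpseries n A) (V : mpseries (n + 1) A) : Prop :=
  ps_dt V = dotv (ps_grad V) (map_mx ps_poly_t N) /\ ps_at_t0 V = U.

End TimeVariable.

Arguments zvec {n A}.
Arguments tvar {n A}.

(* Main.v *)
(* Write K = z + t N and let L be the derivation d/dt - <grad, N>.  A direct
   computation gives L K_i = t L N_i, and the chain rule gives
   L (U o K) = sum_i (dU/dz_i o K) (L K_i).  Moreover F = z - t H satisfies
   F o K = z iff N = H o K, and F o K = z already forces K o F = z.
   If N = H o K, then L N_i = t sum_j (dH_i/dz_j o K) (L N_j), so L N = 0 by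
   induction on the order in t, whence L (U o K) = 0 for every U.
   Conversely U = z_i gives L K = 0, hence L N = 0; so N_i is the solution whose
   initial value is H_i := N_i at t = 0, and therefore N_i = H_i o K. *)
Require Import Defs.
From HB Require Import structures.
From mathcomp Require Import all_boot all_order all_algebra.
From mathcomp Require Import complex.
From mathcomp Require Import mpoly.
From mathcomp Require Import boolp constructive_ereal reals.

Set Implicit Arguments.
Unset Strict Implicit.
Unset Printing Implicit Defensive.

Import Order.TTheory GRing.Theory Num.Theory.

Local Open Scope ring_scope.

(** * Power series: congruences, approximation by polynomials, partial derivatives *)

Section Series.
Variables (n : nat) (A : comNzRingType).
Implicit Types (f g : mpseries n A) (P Q : {mpoly A[n]}) (m a b : 'X_{1..n}).
Implicit Types (S : pred 'X_{1..n}).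

Lemma ps_coefD f g m : (f + g) m = f m + g m. Proof. by []. Qed.
Lemma ps_coefB f g m : (f - g) m = f m - g m. Proof. by []. Qed.

Lemma ps_coef_sum I (r : seq I) (p : pred I) (F : I -> mpseries n A) m :
  (\sum_(i <- r | p i) F i) m = \sum_(i <- r | p i) F i m.
Proof. exact: (big_morph (fun f : mpseries n A => f m)). Qed.

(* Used with the monomials of degree at most [d], and with those in which the
   exponent of [t] is less than [k], i.e. for congruences modulo [t ^ k]. *)
Definition divisor_closed S := forall a b, S (a + b)%MM -> S a /\ S b.

Definition ps_eqon S f g := forall m, S m -> f m = g m.

Lemma ps_eqon_refl S f : ps_eqon S f f. Proof. by []. Qed.

Lemma ps_eqon_sym S f g : ps_eqon S f g -> ps_eqon S g f.
Proof. by move=> fg m /fg. Qed.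

Lemma ps_eqon_trans S f g h : ps_eqon S f g -> ps_eqon S g h -> ps_eqon S f h.
Proof. by move=> fg gh m Sm; rewrite fg ?gh. Qed.

Lemma ps_eqonD S f f' g g' :
  ps_eqon S f f' -> ps_eqon S g g' -> ps_eqon S (f + g) (f' + g').
Proof. by move=> ff gg m Sm; rewrite !ps_coefD ff ?gg. Qed.

Lemma ps_eqon_sum S I (r : seq I) (p : pred I) (F G : I -> mpseries n A) :
    (forall i, p i -> ps_eqon S (F i) (G i)) ->
  ps_eqon S (\sum_(i <- r | p i) F i) (\sum_(i <- r | p i) G i).
Proof.
by move=> FG; elim/big_ind2: _ => // *; exact: ps_eqonD.
Qed.

Section Closed.
Variables (S : pred 'X_{1..n}) (Scl : divisor_closed S).

(** The coefficient of a product at [m] involves the factors only at divisors of [m], and these stay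
    in [S]. *)
Lemma ps_eqonM f f' g g' :
  ps_eqon S f f' -> ps_eqon S g g' -> ps_eqon S (f * g) (f' * g').
Proof.
move=> ff gg m Sm; apply: eq_bigr => k /eqP mE.
have [S1 S2] : S k.1 /\ S k.2 by apply: Scl; rewrite -mE.
by rewrite ff ?gg.
Qed.

Lemma ps_eqonX f g k : ps_eqon S f g -> ps_eqon S (f ^+ k) (g ^+ k).
Proof.
by move=> fg; elim: k => [|k IH] //; rewrite !exprS; exact: ps_eqonM.
Qed.

Lemma ps_eqon_prod I (r : seq I) (p : pred I) (F G : I -> mpseries n A) :
    (forall i, p i -> ps_eqon S (F i) (G i)) ->
  ps_eqon S (\prod_(i <- r | p i) F i) (\prod_(i <- r | p i) G i).
Proof.
by move=> FG; elim/big_ind2: _ => // *; exact: ps_eqonM.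
Qed.

End Closed.

Definition deg_le d : pred 'X_{1..n} := fun m => (mdeg m <= d)%N.

Lemma deg_le_closed d : divisor_closed (deg_le d).
Proof.
move=> a b; rewrite /deg_le mdegD => le_d.
by split; apply: leq_trans le_d; rewrite ?leq_addr ?leq_addl.
Qed.

(** This ring morphism carries identities from polynomials to series: up to any given degree, a
    series agrees with its truncation ([ps_eqon_trunc]). *)
Definition ps_of_mpoly P : mpseries n A := MPSeries (fun m => P@_m).

Lemma ps_of_mpolyB : zmod_morphism ps_of_mpoly.
Proof. by move=> P Q; apply: mpseriesP => m; rewrite /= mcoeffB. Qed.

Lemma ps_of_mpolyM : monoid_morphism ps_of_mpoly.
Proof.
split=> [|P Q]; apply: mpseriesP => m; first by rewrite /= mcoeff1.
by rewrite /= mcoeffM; apply: eq_bigr.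
Qed.

HB.instance Definition _ :=
  GRing.isZmodMorphism.Build _ _ ps_of_mpoly ps_of_mpolyB.
HB.instance Definition _ :=
  GRing.isMonoidMorphism.Build _ _ ps_of_mpoly ps_of_mpolyM.

Lemma ps_eqon_trunc d f : ps_eqon (deg_le d) (ps_of_mpoly (ps_trunc d f)) f.
Proof. exact: ps_approx_trunc. Qed.

Definition ps_C : A -> mpseries n A := ps_of_mpoly \o @mpolyC n A.

HB.instance Definition _ := GRing.RMorphism.on ps_C.

Lemma ps_coefCM c f m : (ps_C c * f) m = c * f m.
Proof.
have T := @ps_eqon_trunc (mdeg m) f.
have lem : deg_le (mdeg m) m by exact: leqnn.
rewrite -(ps_eqonM (@deg_le_closed _) (@ps_eqon_refl _ _) T lem) -(T m lem).
rewrite -[ps_C c]/(ps_of_mpoly c%:MP) -(rmorphM (@ps_of_mpoly)) /=.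
exact: mcoeffCM.
Qed.

Lemma ps_varE (i : 'I_n) : ps_var A i = ps_of_mpoly 'X_i.
Proof. by apply: mpseriesP => m; rewrite /= mcoeffX eq_sym. Qed.

Lemma ps_of_mpolyX m : ps_of_mpoly 'X_[m] = \prod_(i < n) ps_var A i ^+ m i.
Proof.
rewrite mpolyXE_id rmorph_prod; apply: eq_bigr => i _.
by rewrite rmorphXn ps_varE.
Qed.

Lemma ps_coefXM i f m : (ps_var A i * f) (m + U_(i))%MM = f m.
Proof.
have T := @ps_eqon_trunc (mdeg (m + U_(i))) f.
have [le1 le2] := @deg_le_closed _ _ _ (leqnn (mdeg (m + U_(i)))).
rewrite -(ps_eqonM (@deg_le_closed _) (@ps_eqon_refl _ _) T (leqnn _)).
by rewrite -(T _ le1) ps_varE -rmorphM /= mulrC addmC mcoeffMX.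
Qed.

Lemma ps_coefXM0 i f m : m i = 0%N -> (ps_var A i * f) m = 0.
Proof.
move=> mi0; rewrite [LHS]big1 // => k /eqP mE /=.
case: eqP => [kU|_]; last by rewrite mul0r.
have := congr1 (fun a : 'X_{1..n} => a i) mE.
by rewrite /= mi0 mnmDE kU mnm1E eqxx.
Qed.

Lemma mderivXU (i j : 'I_n) : 'X_j^`M(i) = (i == j)%:R :> {mpoly A[n]}.
Proof.
rewrite mderivX mnm1E eq_sym.
have [->|_] := eqVneq i j; last by rewrite scale0r.
by rewrite -{1}[U_(j)%MM]add0m addmK mpolyX0 scale1r.
Qed.

Lemma ps_derivB i : zmod_morphism (@ps_deriv A n i).
Proof. by move=> f g; apply: mpseriesP => m; rewrite /= mulrnBl. Qed.

HB.instance Definition _ i :=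
  GRing.isZmodMorphism.Build _ _ (@ps_deriv A n i) (ps_derivB i).

Lemma ps_deriv_mpoly i P :
  ps_deriv i (ps_of_mpoly P) = ps_of_mpoly P^`M(i).
Proof. by apply: mpseriesP => m; rewrite /= mcoeff_deriv. Qed.

Lemma ps_deriv_var (i j : 'I_n) : ps_deriv i (ps_var A j) = (i == j)%:R.
Proof. by rewrite ps_varE ps_deriv_mpoly mderivXU rmorph_nat. Qed.

Lemma ps_deriv_eqon i d f g :
    ps_eqon (deg_le d.+1) f g ->
  ps_eqon (deg_le d) (ps_deriv i f) (ps_deriv i g).
Proof. by move=> fg m md; rewrite /= fg // /deg_le mdegD mdeg1 addn1. Qed.

Lemma ps_eqon_deg f g :
  (forall d, ps_eqon (deg_le d) f g) -> f = g.
Proof.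
by move=> fg; apply: mpseriesP => m; apply: (fg (mdeg m)); exact: leqnn.
Qed.

Lemma ps_eqon_degS d f g : ps_eqon (deg_le d.+1) f g -> ps_eqon (deg_le d) f g.
Proof. by move=> fg m md; apply: fg; apply: leqW. Qed.

Lemma ps_derivM i f g :
  ps_deriv i (f * g) = ps_deriv i f * g + f * ps_deriv i g.
Proof.
(* Truncation is at [d.+1] because differentiation costs one degree of precision. *)
apply: ps_eqon_deg => d; have T := @ps_eqon_trunc d.+1.
have cl := @deg_le_closed d.
apply: (@ps_eqon_trans _ _ (ps_deriv i
   (ps_of_mpoly (ps_trunc d.+1 f) * ps_of_mpoly (ps_trunc d.+1 g)))).
  by apply/ps_deriv_eqon/ps_eqon_sym/ps_eqonM => //; exact: deg_le_closed.
rewrite -rmorphM ps_deriv_mpoly mderivM !(rmorphD, rmorphM) /= -!ps_deriv_mpoly.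
by apply: ps_eqonD; apply: ps_eqonM => //; do ?[exact: ps_deriv_eqon];
  apply: ps_eqon_degS.
Qed.

End Series.

(** * Substitution of series: ring morphism, chain rule, associativity *)

Section Composition.
Variables (k n : nat) (A : comNzRingType).
Implicit Types (f : mpseries k A) (g : 'cV[mpseries n A]_k) (P : {mpoly A[k]}).

(** The condition under which [ps_comp] is genuine substitution rather than a junk value. *)
Definition null_const g := forall i, g i 0 0%MM = 0.

Definition ps_eval g : {mpoly A[k]} -> mpseries n A :=
  mmap (@ps_C n A) (fun i => g i 0).

HB.instance Definition _ g := GRing.RMorphism.on (ps_eval g).

Lemma ps_evalC g c : ps_eval g c%:MP = ps_C n c.
Proof. exact: mmapC. Qed.

Lemma ps_evalXU g i : ps_eval g 'X_i = g i 0.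
Proof. by rewrite /ps_eval mmapX mmap1U. Qed.

Lemma ps_evalZ g c P : ps_eval g (c *: P) = ps_C n c * ps_eval g P.
Proof. exact: mmapZ. Qed.

Lemma ps_evalX g a : ps_eval g 'X_[a] = \prod_(i < k) g i 0 ^+ a i.
Proof. by rewrite /ps_eval mmapX. Qed.

(** If [m = b.1 + b.2] has degree below [p + q], then [b.1] has degree below [p] or [b.2] has degree
    below [q]. *)
Lemma ps_low_mul p q (f g : mpseries n A) :
    (forall m, (mdeg m < p)%N -> f m = 0) ->
    (forall m, (mdeg m < q)%N -> g m = 0) ->
  forall m, (mdeg m < p + q)%N -> (f * g) m = 0.
Proof.
move=> f0 g0 m mpq; rewrite [LHS]big1 // => b /eqP mE.
have [lt_p|le_p] := ltnP (mdeg b.1) p; first by rewrite f0 ?mul0r.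
rewrite (g0 b.2) ?mulr0 // -(ltn_add2l (mdeg b.1)) -mdegD -mE.
by rewrite (leq_trans mpq) // leq_add2r.
Qed.

(** This justifies the cut-off at [mdeg m] in the definition of [ps_comp]. *)
Lemma ps_low_monom g a m : null_const g -> (mdeg m < mdeg a)%N ->
  (\prod_(i < k) g i 0 ^+ a i) m = 0.
Proof.
move=> g0; rewrite [mdeg a]mdegE; move: m.
apply: (big_ind2 (fun (f : mpseries n A) d =>
  forall m, (mdeg m < d)%N -> f m = 0)) => // [f p f' q f0 f'0|i _].
  exact: ps_low_mul f0 f'0.
elim: (a i) => // d IH; rewrite exprS -addn1 addnC.
apply: ps_low_mul => // m; rewrite ltnS leqn0 mdeg_eq0 => /eqP ->; exact: g0.
Qed.

Lemma ps_eval_low g P m : null_const g ->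
  (forall a, (mdeg a <= mdeg m)%N -> P@_a = 0) -> ps_eval g P m = 0.
Proof.
move=> g0 P0; rewrite ps_coef_sum big1 // => a _.
rewrite ps_coefCM; have [/P0 ->|lt] := leqP (mdeg a) (mdeg m).
  by rewrite mul0r.
by rewrite ps_low_monom ?mulr0.
Qed.

(** When [P] is the truncation of [f] at degree [mdeg m], this is the definition of [ps_comp]. Any
    other admissible [P] differs from it only in degrees above [mdeg m], which contribute nothing at
    [m] by [ps_eval_low]. *)
Lemma ps_compE f g P m : null_const g ->
    ps_eqon (deg_le (mdeg m)) f (ps_of_mpoly P) ->
  ps_comp f g m = ps_eval g P m.
Proof.
move=> g0 fP; transitivity (ps_eval g (ps_trunc (mdeg m) f) m).
  rewrite rmorph_sum ps_coef_sum; apply: eq_bigr => a _.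
  by rewrite /= ps_evalZ ps_coefCM ps_evalX.
apply/eqP; rewrite -subr_eq0 -ps_coefB -rmorphB; apply/eqP.
apply: ps_eval_low => // a le.
by rewrite mcoeffB (ps_approx_trunc f le) (fP a le) subrr.
Qed.

Lemma ps_comp_mpoly g P : null_const g ->
  ps_comp (ps_of_mpoly P) g = ps_eval g P.
Proof. by move=> g0; apply: mpseriesP => m; exact: ps_compE. Qed.

Lemma ps_comp_approx d f g P : null_const g ->
    ps_eqon (deg_le d) f (ps_of_mpoly P) ->
  ps_eqon (deg_le d) (ps_comp f g) (ps_eval g P).
Proof.
move=> g0 fP m md; apply: ps_compE => // a am; apply: fP.
exact: leq_trans am md.
Qed.

Lemma ps_comp_eqon_l d f f' g :
  ps_eqon (deg_le d) f f' -> ps_eqon (deg_le d) (ps_comp f g) (ps_comp f' g).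
Proof.
move=> ff m md; apply: eq_bigr => a _; rewrite ff //.
by rewrite /deg_le (leq_trans _ md) // -ltnS bmdeg.
Qed.

Lemma ps_compB g : zmod_morphism (fun f => ps_comp f g).
Proof.
move=> f f'; apply: mpseriesP => m; rewrite ps_coefB -sumrB.
by apply: eq_bigr => a _; rewrite -mulrBl.
Qed.

Lemma ps_compM g f f' : null_const g ->
  ps_comp (f * f') g = ps_comp f g * ps_comp f' g.
Proof.
move=> g0; apply: ps_eqon_deg => d; have T := @ps_eqon_trunc _ _ d.
have cl := @deg_le_closed k d; have cl' := @deg_le_closed n d.
pose P := ps_trunc d f; pose P' := ps_trunc d f'.
apply: (@ps_eqon_trans _ _ _ _ (ps_eval g (P * P'))).
  apply: ps_comp_approx => //; rewrite rmorphM.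
  by apply: ps_eqonM => //; apply/ps_eqon_sym/T.
rewrite rmorphM; apply/ps_eqon_sym/ps_eqonM => //;
  by apply: ps_comp_approx => //; apply/ps_eqon_sym/T.
Qed.

Lemma ps_comp_monoid g : null_const g -> monoid_morphism (fun f => ps_comp f g).
Proof.
move=> g0; split=> [|f f']; last exact: ps_compM.
by rewrite -(rmorph1 (@ps_of_mpoly k A)) ps_comp_mpoly ?rmorph1.
Qed.

(** The morphism structure depends on the proof [g0], hence the explicit packing. *)
Definition ps_comp_rmorph g (g0 : null_const g) :
    {rmorphism mpseries k A -> mpseries n A} :=
  HB.pack_for {rmorphism mpseries k A -> mpseries n A} (fun f => ps_comp f g)
    (GRing.isZmodMorphism.Build _ _ _ (@ps_compB g))
    (GRing.isMonoidMorphism.Build _ _ _ (ps_comp_monoid g0)).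

Lemma ps_comp_var g i : null_const g -> ps_comp (ps_var A i) g = g i 0.
Proof. by move=> g0; rewrite ps_varE ps_comp_mpoly // ps_evalXU. Qed.

Lemma ps_compC g c : null_const g -> ps_comp (ps_C k c) g = ps_C n c.
Proof. by move=> g0; rewrite [LHS]ps_comp_mpoly // ps_evalC. Qed.

(** The coefficients of [f] and the range of summation are the same on both sides, so only the
    products of powers of the inner series are compared. *)
Lemma ps_comp_eqon_r S f g g' : divisor_closed S ->
    (forall i, ps_eqon S (g i 0) (g' i 0)) ->
  ps_eqon S (ps_comp f g) (ps_comp f g').
Proof.
move=> Scl gg m Sm; apply: eq_bigr => a _; congr (_ * _).
by apply: (ps_eqon_prod Scl) => // i _; apply: ps_eqonX.
Qed.

(** Both sides are additive in [P] and satisfy the Leibniz rule along [ps_eval g], so agreement on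
    constants and variables suffices. *)
Lemma ps_eval_chain j g P :
  ps_deriv j (ps_eval g P) =
  \sum_(i < k) ps_eval g P^`M(i) * ps_deriv j (g i 0).
Proof.
pose D P := \sum_(i < k) ps_eval g P^`M(i) * ps_deriv j (g i 0).
rewrite -[RHS]/(D P); set Q := fun P => ps_deriv j (ps_eval g P) = D P.
have DM p q : D (p * q) = D p * ps_eval g q + ps_eval g p * D q.
  rewrite mulr_suml mulr_sumr -big_split; apply: eq_bigr => i _ /=.
  by rewrite mderivM rmorphD !rmorphM /= mulrDl mulrA mulrAC.
have QM p q : Q p -> Q q -> Q (p * q).
  by move=> Qp Qq; rewrite /Q DM -Qp -Qq rmorphM ps_derivM.
have QD p q : Q p -> Q q -> Q (p + q).
  rewrite /Q rmorphD raddfD /= => -> ->; rewrite -big_split.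
  by apply: eq_bigr => i _; rewrite mderivD rmorphD mulrDl.
have QC c : Q c%:MP.
  rewrite /Q ps_evalC [LHS]ps_deriv_mpoly mderivC raddf0 /D big1 // => i _.
  by rewrite mderivC raddf0 mul0r.
have QX i : Q 'X_i.
  rewrite /Q ps_evalXU /D (bigD1 i) //= big1 => [|l li].
    by rewrite mderivXU eqxx rmorph1 mul1r addr0.
  by rewrite mderivXU (negbTE li) raddf0 mul0r.
elim/mpolyind: P => [|c a p _ _ Qp]; first by rewrite -mpolyC0; exact: QC.
apply: QD => //; rewrite -mul_mpolyC; apply: (QM) => //.
rewrite mpolyXE_id; apply: (big_ind Q) => [|p1 p2|i _].
- by rewrite -mpolyC1.
- exact: QM.
elim: (a i) => [|d IH]; first by rewrite expr0 -mpolyC1.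
by rewrite exprS; apply: (QM).
Qed.

Lemma ps_comp_chain j f g : null_const g ->
  ps_deriv j (ps_comp f g) =
  \sum_(i < k) ps_comp (ps_deriv i f) g * ps_deriv j (g i 0).
Proof.
move=> g0; apply: ps_eqon_deg => d; pose P := ps_trunc d.+1 f.
have T : ps_eqon (deg_le d.+1) f (ps_of_mpoly P).
  exact/ps_eqon_sym/ps_eqon_trunc.
apply: (@ps_eqon_trans _ _ _ _ (ps_deriv j (ps_eval g P))).
  exact/ps_deriv_eqon/ps_comp_approx.
rewrite ps_eval_chain; apply: ps_eqon_sum => i _.
apply: ps_eqonM => //; first exact: deg_le_closed.
apply/ps_eqon_sym/ps_comp_approx => //; rewrite -ps_deriv_mpoly.
exact: ps_deriv_eqon.
Qed.

End Composition.

Lemma ps_comp_null k n A (f : mpseries k A) (g : 'cV[mpseries n A]_k) :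
  f 0%MM = 0 -> null_const g -> ps_comp f g 0%MM = 0.
Proof.
move=> f0 g0; rewrite (@ps_compE _ _ _ _ _ 0) ?raddf0 // => a.
by rewrite /deg_le mdeg0 leqn0 mdeg_eq0 => /eqP ->; rewrite f0.
Qed.

(** Up to degree [d], [f] may be replaced by a polynomial; composition with [h], a ring morphism
    fixing constants, then passes through its monomials. *)
Lemma ps_compA l k n A (f : mpseries l A) (g : 'cV[mpseries k A]_l)
    (h : 'cV[mpseries n A]_k) :
    null_const g -> null_const h ->
  ps_comp (ps_comp f g) h = ps_comp f (map_mx (fun u => ps_comp u h) g).
Proof.
move=> g0 h0; set gh := map_mx _ g.
have gh0 : null_const gh by move=> i; rewrite mxE; apply: ps_comp_null.
apply: ps_eqon_deg => d; pose P := ps_trunc d f.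
have T : ps_eqon (deg_le d) f (ps_of_mpoly P).
  exact/ps_eqon_sym/ps_eqon_trunc.
apply: (@ps_eqon_trans _ _ _ _ (ps_comp (ps_eval g P) h)).
  exact/ps_comp_eqon_l/ps_comp_approx.
suff -> : ps_comp (ps_eval g P) h = ps_eval gh P.
  exact/ps_eqon_sym/ps_comp_approx.
rewrite /ps_eval /mmap -[ps_comp _ h]/(ps_comp_rmorph h0 _) rmorph_sum.
apply: eq_bigr => a _; rewrite rmorphM /= ps_compC //; congr (_ * _).
rewrite /mmap1 -[ps_comp _ h]/(ps_comp_rmorph h0 _) rmorph_prod.
by apply: eq_bigr => i _; rewrite rmorphXn mxE.
Qed.

Lemma ps_comp_id n A (f : mpseries n A) : ps_comp f (\col_i ps_var A i) = f.
Proof.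
have v0 : null_const (\col_i ps_var A i : 'cV[mpseries n A]_n).
  by move=> i; rewrite mxE /= eq_sym mnm1_eq0.
apply: mpseriesP => m.
rewrite (@ps_compE _ _ _ _ _ (ps_trunc (mdeg m) f)) //; last first.
  exact/ps_eqon_sym/ps_eqon_trunc.
rewrite -(@ps_eqon_trunc _ _ (mdeg m) f m (leqnn _)); congr (pscoef _ m).
rewrite (mpolyE (ps_trunc _ f)) !raddf_sum; apply: eq_bigr => a _.
rewrite /= ps_evalZ ps_evalX -mul_mpolyC rmorphM /= ps_of_mpolyX; congr (_ * _).
by apply: eq_bigr => i _; rewrite mxE.
Qed.

(** * Series in [z] and [t]: congruences modulo powers of [t], substitution for [z] *)

Section Time.
Variables (n : nat) (A : comNzRingType).
Local Notation zt := (mpseries (n + 1) A).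
Implicit Types (V W : zt) (f : mpseries n A) (m : 'X_{1..n + 1}).
Implicit Types (G N : 'cV[zt]_n) (H : 'cV[mpseries n A]_n).

Local Notation t_ := (tidx n).
Local Notation z_ := (@zidx n).

Definition t_lt k : pred 'X_{1..n + 1} := fun m => (m t_ < k)%N.

Lemma t_lt_closed k : divisor_closed (t_lt k).
Proof.
move=> a b; rewrite /t_lt mnmDE => lt_k.
by split; apply: leq_ltn_trans lt_k; rewrite ?leq_addr ?leq_addl.
Qed.

Lemma ps_eqon_t V W : (forall k, ps_eqon (t_lt k) V W) -> V = W.
Proof.
by move=> VW; apply: mpseriesP => m; apply: (VW (m t_).+1); exact: ltnSn.
Qed.

Lemma t_exp_gt0 m : m t_ != 0%N -> {m' | m = (m' + U_(t_))%MM}.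
Proof.
move=> mt; exists (m - U_(t_))%MM; rewrite submK //.
by apply/mnm_lepP => j; rewrite mnm1E; case: eqP => // <-; rewrite lt0n.
Qed.

(** The gain of one order in [t] that drives the inductions below. *)
Lemma tvarM_eqon k V W :
  ps_eqon (t_lt k) V W -> ps_eqon (t_lt k.+1) (tvar * V) (tvar * W).
Proof.
move=> VW m; rewrite /t_lt; have [m0 _|/t_exp_gt0 [m' ->]] := eqVneq (m t_) 0%N.
  by rewrite !ps_coefXM0.
by rewrite !ps_coefXM mnmDE mnm1E eqxx (addn1 (m' _)) ltnS => /VW.
Qed.

Lemma tvarI V W : tvar * V = tvar * W -> V = W.
Proof.
move=> VW; apply: mpseriesP => m.
by rewrite -(ps_coefXM t_ V) -(ps_coefXM t_ W); congr (pscoef _ _).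
Qed.

(** Differentiation in [z] leaves the exponent of [t] unchanged, so no precision in [t] is lost. *)
Lemma ps_derivz_eqon k i V W :
    ps_eqon (t_lt k) V W ->
  ps_eqon (t_lt k) (ps_deriv (z_ i) V) (ps_deriv (z_ i) W).
Proof.
move=> VW m mk /=; rewrite VW // /t_lt mnmDE mnm1E.
by rewrite (_ : z_ i == t_ = false) ?addn0 // eq_lrshift.
Qed.

Lemma ztexp_z a k i : ztexp a k (z_ i) = a i.
Proof.
rewrite /ztexp mnmE; case: splitP => [j /= /val_inj -> //|j /= E].
by have := ltn_ord i; rewrite E ltnNge leq_addr.
Qed.

Lemma ztexp_t (a : 'X_{1..n}) k : ztexp a k t_ = k.
Proof.
rewrite /ztexp mnmE; case: splitP => [j /= E|//].
by have := ltn_ord j; rewrite -E addn0 ltnn.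
Qed.

Lemma zexpK (a : 'X_{1..n}) k : zexp (ztexp a k) = a.
Proof. by apply/mnmP => i; rewrite /zexp mnmE ztexp_z. Qed.

Lemma ztexpK m : ztexp (zexp m) (m t_) = m.
Proof.
apply/mnmP => j; rewrite -(splitK j); case: (split j) => i /=.
  by rewrite ztexp_z /zexp mnmE.
by rewrite (ord1 i) ztexp_t.
Qed.

Lemma mdeg_zt m : mdeg m = (mdeg (zexp m) + m t_)%N.
Proof.
rewrite !mdegE big_split_ord big_ord1; congr (_ + _)%N.
by apply: eq_bigr => i _; rewrite /zexp mnmE.
Qed.

Lemma at_t0_eqon V W : ps_eqon (t_lt 1) V W -> ps_at_t0 V = ps_at_t0 W.
Proof.
by move=> VW; apply: mpseriesP => m; apply: VW; rewrite /t_lt ztexp_t.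
Qed.

Lemma eqon_at_t0 V W m : ps_at_t0 V = ps_at_t0 W -> m t_ = 0%N -> V m = W m.
Proof.
move=> VW m0; rewrite -(ztexpK m) m0.
exact: (congr1 (fun f : mpseries n A => f (zexp m)) VW).
Qed.

Lemma at_t0_const f : ps_at_t0 (ps_const_t f) = f.
Proof. by apply: mpseriesP => m; rewrite /= ztexp_t zexpK. Qed.

(** Only exponents without [t] contribute; [b |-> ztexp b 0] parametrizes them and preserves
    degrees, so the two cut-offs match. *)
Lemma compz_const f G : compz (ps_const_t f) G = ps_comp f G.
Proof.
apply: mpseriesP => m /=; set d := (mdeg m).+1.
have le_zt (b : 'X_{1..n < d}) : (mdeg (ztexp b 0) < d)%N.
  by rewrite mdeg_zt zexpK ztexp_t addn0 bmdeg.
have le_z (a : bmultinom (n + 1) d) : (mdeg (zexp (bmnm a)) < d)%N.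
  by rewrite (leq_ltn_trans _ (bmdeg a)) // (mdeg_zt (bmnm a)) leq_addr.
rewrite (bigID (fun a : bmultinom (n + 1) d => bmnm a t_ == 0%N)) /= addrC.
rewrite big1 => [|a /negbTE ->]; last by rewrite mul0r.
rewrite add0r (reindex_onto (fun b : 'X_{1..n < d} => BMultinom (le_zt b))
  (fun a => BMultinom (le_z a))) /=; last first.
  by move=> a /eqP a0; apply/val_inj; rewrite /= -[RHS]ztexpK a0.
apply: eq_big => [b|b _]; last first.
  rewrite ztexp_t zexpK; congr (_ * pscoef _ _).
  rewrite big_split_ord big_ord1 /= ztexp_t expr0 mulr1.
  by apply: eq_bigr => i _; rewrite col_mxEu ztexp_z.
by rewrite ztexp_t eqxx -val_eqE /= zexpK eqxx.
Qed.

Definition zt_col G : 'cV[zt]_(n + 1) := col_mx G (const_mx tvar).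

Lemma null_zt_col G : null_const G -> null_const (zt_col G).
Proof.
move=> G0 j; rewrite -(splitK j) /zt_col; case: (split j) => i /=.
  by rewrite col_mxEu.
by rewrite col_mxEd mxE /= eq_sym mnm1_eq0.
Qed.

Lemma null_zvec : null_const (zvec : 'cV[zt]_n).
Proof. by move=> i; rewrite mxE /= eq_sym mnm1_eq0. Qed.

Lemma null_tvarM V : (tvar * V) 0%MM = 0.
Proof. by rewrite ps_coefXM0 // mnmE. Qed.

Lemma compz_z G i : null_const G -> compz (zvec i 0) G = G i 0.
Proof.
by move=> G0; rewrite /compz mxE ps_comp_var ?col_mxEu //; exact: null_zt_col.
Qed.

Lemma compz_t G : null_const G -> compz tvar G = tvar.
Proof.
by move=> G0; rewrite /compz ps_comp_var ?col_mxEd ?mxE //; exact: null_zt_col.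
Qed.

Lemma compz_zvec V : compz V zvec = V.
Proof.
rewrite -[RHS]ps_comp_id /compz; congr ps_comp.
apply/colP => j; rewrite -(splitK j) mxE; case: (split j) => i /=.
  by rewrite col_mxEu mxE.
by rewrite col_mxEd mxE (ord1 i).
Qed.

Lemma ps_const_tE f : ps_const_t f = ps_comp f zvec.
Proof. by rewrite -compz_const compz_zvec. Qed.

(** For [V] a component of [zvec], this computes a component of [(z - t H) o G]. *)
Lemma compz_sub_tM V f G : null_const G ->
  compz (V - tvar * ps_const_t f) G = compz V G - tvar * ps_comp f G.
Proof.
move=> G0; rewrite -compz_const -{2}(compz_t G0) /compz ps_compB ps_compM //.
exact: null_zt_col.
Qed.

Lemma compz_comp V G G' : null_const G -> null_const G' ->
  compz (compz V G) G' = compz V (map_mx (fun u => compz u G') G).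
Proof.
move=> G0 G0'; rewrite /compz ps_compA; try exact: null_zt_col.
by congr ps_comp; rewrite map_col_mx map_const_mx [ps_comp tvar _]compz_t.
Qed.

(** * The inverse pair [F = z - t H], [K = z + t N], and the transport equation *)

Section Inverse.
Variables (H : 'cV[mpseries n A]_n) (N : 'cV[zt]_n).
Let F : 'cV[zt]_n := zvec - tvar *: map_mx (@ps_const_t n A) H.
Let K : 'cV[zt]_n := zvec + tvar *: N.

Let FE i : F i 0 = zvec i 0 - tvar * ps_const_t (H i 0).
Proof. by rewrite /F !mxE. Qed.

Let KE i : K i 0 = zvec i 0 + tvar * N i 0.
Proof. by rewrite /K !mxE. Qed.

Lemma null_flow : null_const K.
Proof. by move=> i; rewrite KE ps_coefD null_zvec null_tvarM addr0. Qed.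

Let F0 : null_const F.
Proof. by move=> i; rewrite FE ps_coefB null_zvec null_tvarM subr0. Qed.

(** Here [F o K = z + t N - t (H o K)], and the factor [t] can be cancelled by [tvarI]. *)
Lemma right_inverseP :
  map_mx (fun u => compz u K) F = zvec <-> forall i, N i 0 = ps_comp (H i 0) K.
Proof.
have E i : compz (F i 0) K = zvec i 0 + tvar * N i 0 - tvar * ps_comp (H i 0) K.
  by rewrite FE compz_sub_tM ?compz_z ?KE //; exact: null_flow.
split=> [FK i|NH].
  move/colP/(_ i): FK; rewrite mxE E -addrA => /(canRL (addKr _)).
  by rewrite addNr => /subr0_eq /tvarI.
by apply/colP => i; rewrite mxE E -NH addrK.
Qed.

(* [L := K o F] satisfies [F o L = F], that is [L - z = t (H(L) - H(z))], so [L]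
   and [z] agree to every order in [t]. *)
Lemma right_inverse_inverse :
  map_mx (fun u => compz u K) F = zvec -> formal_inverse F K.
Proof.
move=> FK; split=> //; set L := map_mx _ K.
have K0 := null_flow.
have L0 : null_const L.
  by move=> i; rewrite mxE; apply: ps_comp_null => //; exact: null_zt_col.
have LE i : L i 0 = zvec i 0
    + (tvar * ps_comp (H i 0) L - tvar * ps_comp (H i 0) zvec).
  have : compz (F i 0) L = F i 0.
    (* Associativity: [F o (K o F) = (F o K) o F = z o F]. *)
    rewrite -compz_comp //.
    have -> : compz (F i 0) K = zvec i 0.
      by move/colP/(_ i): FK; rewrite mxE.
    by rewrite compz_z.
  rewrite FE compz_sub_tM // compz_z // -ps_const_tE => /(canRL (subrK _)) ->.
  by rewrite -addrA [- _ + _]addrC.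
have Lz k : forall i, ps_eqon (t_lt k) (L i 0) (zvec i 0).
  elim: k => // k IH i; rewrite LE -[X in ps_eqon _ _ X]addr0.
  apply: ps_eqonD => // m mk; rewrite ps_coefB.
  rewrite (tvarM_eqon (ps_comp_eqon_r (H i 0) (@t_lt_closed k) IH) mk).
  exact: subrr.
by apply/colP => i; apply: ps_eqon_t => k; exact: Lz.
Qed.

(* [transport V = 0] is the differential equation of the Cauchy problem; as a
   derivation, [transport] obeys the chain rule [transport_comp]. *)
Definition transport V := ps_dt V - dotv (ps_grad V) N.

Lemma transportE V :
  transport V = ps_dt V - \sum_j ps_deriv (z_ j) V * N j 0.
Proof. by congr (_ - _); apply: eq_bigr => j _; rewrite mxE. Qed.

Lemma transport_comp f :
  transport (ps_comp f K) =
  \sum_(i < n) ps_comp (ps_deriv i f) K * transport (K i 0).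
Proof.
have K0 := null_flow; rewrite transportE /ps_dt ps_comp_chain //.
under [X in _ - X]eq_bigr do rewrite ps_comp_chain // mulr_suml.
rewrite exchange_big -sumrB; apply: eq_bigr => i _.
rewrite transportE mulrBr mulr_sumr; congr (_ - _).
by apply: eq_bigr => j _; rewrite mulrA.
Qed.

(** The time derivative of [K i 0] is [N_i + t dN_i/dt], and its gradient paired with [N] is
    [N_i + t <grad N_i, N>]; the two terms [N_i] cancel. *)
Lemma transport_flow i : transport (K i 0) = tvar * transport (N i 0).
Proof.
have dK j : ps_deriv j (K i 0) =
    (j == z_ i)%:R + ((j == t_)%:R * N i 0 + tvar * ps_deriv j (N i 0)).
  by rewrite KE raddfD /= mxE ps_deriv_var ps_derivM ps_deriv_var.
rewrite !transportE /ps_dt dK eq_rlshift eqxx add0r mul1r.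
have -> : \sum_j ps_deriv (z_ j) (K i 0) * N j 0 =
    N i 0 + tvar * \sum_j ps_deriv (z_ j) (N i 0) * N j 0.
  under eq_bigr do rewrite dK eq_lrshift mul0r add0r eq_lshift mulrDl.
  rewrite big_split mulr_sumr (bigD1 i) //= eqxx mul1r big1 => [|j ji].
    by rewrite addr0; congr (_ + _); apply: eq_bigr => j _; rewrite mulrA.
  by rewrite (negbTE ji) mul0r.
by rewrite mulrBr opprD addrACA subrr add0r.
Qed.

(** The conclusion is the inviscid Burgers equation for [N]. The chain rule and [transport_flow]
    express each [transport (N i 0)] as [t] times a combination of all of them, so vanishing modulo
    [t ^ k] improves to [t ^ k.+1]. *)
Lemma transport_velocity : (forall i, N i 0 = ps_comp (H i 0) K) ->
  forall i, transport (N i 0) = 0.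
Proof.
move=> NH i; apply: ps_eqon_t => k; elim: k i => // k IH i.
have -> : transport (N i 0) = tvar *
    \sum_(j < n) ps_comp (ps_deriv j (H i 0)) K * transport (N j 0).
  rewrite {1}NH transport_comp mulr_sumr; apply: eq_bigr => j _.
  by rewrite transport_flow mulrCA.
(* Zero takes the shape of the right-hand side above, so that the congruence lemmas apply term by
   term. *)
have E0 : 0 = tvar * \sum_(j < n) ps_comp (ps_deriv j (H i 0)) K * 0.
  by rewrite big1 => [|j _]; rewrite mulr0.
rewrite [X in ps_eqon _ _ X]E0; apply/tvarM_eqon/ps_eqon_sum => j _.
by apply: ps_eqonM => //; exact: t_lt_closed.
Qed.

End Inverse.

(** Modulo [t], that is on [t_lt 1], the inner series is [z] itself. *)
Lemma at_t0_comp f N : ps_at_t0 (ps_comp f (zvec + tvar *: N)) = f.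
Proof.
rewrite -[RHS]at_t0_const ps_const_tE; apply: at_t0_eqon.
apply: ps_comp_eqon_r => [|i]; first exact: t_lt_closed.
rewrite -[X in ps_eqon _ _ X]addr0 !mxE; apply: ps_eqonD => // m mt.
by rewrite ps_coefXM0 //; move: mt; rewrite /t_lt ltnS leqn0 => /eqP.
Qed.

Lemma transport_eq0 N V : ps_dt V = dotv (ps_grad V) N <-> transport N V = 0.
Proof. by split=> [E|/subr0_eq //]; rewrite /transport E subrr. Qed.

End Time.

(** If [V] and [W] agree modulo [t ^ k], the equation makes their time derivatives agree modulo
    [t ^ k]. This settles the exponents of [t] from 1 to [k]; exponent 0 is the initial value. *)
Lemma transport_unique n (A : numDomainType) (N : 'cV[mpseries (n + 1) A]_n)
    V W :
    transport N V = 0 -> transport N W = 0 -> ps_at_t0 V = ps_at_t0 W ->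
  V = W.
Proof.
move=> V0 W0 VW; apply: ps_eqon_t => k; elim: k => // k IH m mk.
have [m0|/t_exp_gt0 [m' mE]] := eqVneq (m (tidx n)) 0%N.
  exact: eqon_at_t0.
have /(_ m') : ps_eqon (t_lt k) (ps_dt V) (ps_dt W).
  have /subr0_eq -> := V0; have /subr0_eq -> := W0.
  apply: ps_eqon_sum => j _; apply: ps_eqonM => //; first exact: t_lt_closed.
  by rewrite !mxE; exact: ps_derivz_eqon.
move: mk; rewrite /t_lt mE mnmDE mnm1E eqxx (addn1 (m' _)) ltnS => mk /(_ mk).
(* The time derivative carries the positive factor [(m' t).+1], which is cancelled in characteristic
   zero. *)
exact: pmulrnI.
Qed.

Theorem proposition2p10 (R : realType) (n : nat)
    (N : 'cV[mpseries n {poly R[i]}]_n) :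
  (1 <= n)%N ->
  (1%:E <= ps_vorder N)%E ->
  (exists H : 'cV[mpseries n R[i]]_n,
     formal_inverse (zvec - tvar *: map_mx (@ps_const_t n R[i]) H)
                    (zvec + tvar *: map_mx (@ps_poly_t n R[i]) N))
  <->
  (forall U : mpseries n R[i],
     unique (cauchy_solution N U)
            (ps_comp U (zvec + tvar *: map_mx (@ps_poly_t n R[i]) N))).
Proof.
move=> _ _; rewrite /cauchy_solution; set M := map_mx _ N; set K := zvec + _.
split=> [[H [/right_inverseP NH _]] U|sol].
  have K0 : transport M (ps_comp U K) = 0.
    rewrite transport_comp big1 // => i _.
    by rewrite transport_flow (transport_velocity NH) !mulr0.
  split=> [|V [/transport_eq0 V0 Vt]].
    by split; [exact/transport_eq0 | exact: at_t0_comp].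
  by apply: (transport_unique K0 V0); rewrite Vt; exact: at_t0_comp.
exists (map_mx (@ps_at_t0 n R[i]) M); apply/right_inverse_inverse/right_inverseP.
move=> i; rewrite [in RHS]mxE.
(* Uniqueness identifies [M i 0] with [H_i o K] once [M i 0] is shown to solve the equation. *)
have [_ /(_ (M i 0)) -> //] := sol (ps_at_t0 (M i 0)).
(* After multiplication by [t] the claim becomes [transport M (K i 0) = 0], which is the hypothesis
   for [U = z_i]. *)
split=> //; apply/transport_eq0/tvarI; rewrite mulr0 -transport_flow.
have [[/transport_eq0 + _] _] := sol (ps_var _ i).
by rewrite ps_comp_var //; exact: null_flow.
Qed.
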